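(* Let $d\geq 1$ be an integer and, for $x\in[0,\infty)$, let $$m(x)=\frac{2^{\frac d2}\,\Gamma\left(\frac{d+1}{2}\right)}{\sqrt{\pi}}\int_{2\pi x}^{\infty} r^{-\frac d2}J_{\frac d2}(r)\,\mathrm{d}r .$$ Then for all $t>0$ and $\xi\in\mathbb{R}^d$, $$1-\frac{2}{\pi}\int_0^{\pi}\frac{\sin s}{s}\,\mathrm{d}s\;\leq\; m(t|\xi|)\;\leq\; 1,$$ and $$\max_{0\leq t|\xi|<\infty}|m(t|\xi|)|=m(0)=1 .$$
   Context: $J_\alpha$ denotes the Bessel function of the first kind of order $\alpha$, $J_\alpha(r)=\sum_{k=0}^\infty \frac{(-1)^k}{\Gamma(k+\alpha+1)\,k!}\left(\frac r2\right)^{2k+\alpha}$ for $r>0$. The integral to $\infty$ is understood as a (possibly improper) integral $\lim_{R\to\infty}\int_{2\pi x}^{R}$. $|\xi|$ is the Euclidean norm. *)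

(* Defs.v *)
(* MathComp-Analysis, over an arbitrary R : realType. *)
From HB Require Import structures.
From mathcomp Require Import all_boot all_order all_algebra.
From mathcomp Require Import all_classical all_reals all_analysis.

Set Implicit Arguments.
Unset Strict Implicit.
Unset Printing Implicit Defensive.

Import Order.TTheory GRing.Theory Num.Theory.
Import numFieldNormedType.Exports.

Local Open Scope classical_set_scope.
Local Open Scope ring_scope.

(* Euler's integral; it is the Gamma function for a > 0 only. *)
Definition Gamma (R : realType) (a : R) : R :=
  \int[lebesgue_measure]_(t in `]0, +oo[) (t `^ (a - 1) * expR (- t)).

Definition besselJ_coef (R : realType) (alpha r : R) : R^nat := fun k =>
  (-1) ^+ k / (Gamma (k%:R + alpha + 1) * k`!%:R)
  * (r / 2) `^ (2 * k%:R + alpha).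

(* Meaningful for 0 < r and -1 < alpha, where all the arguments of Gamma are
   positive. *)
Definition besselJ (R : realType) (alpha r : R) : R :=
  limn (series (besselJ_coef alpha r)).

Definition integral_upto (R : realType) (f : R -> R) (a b : R) : R :=
  \int[lebesgue_measure]_(r in `[a, b]) f r.

(* The integral over [a, +oo[ is not a Lebesgue integral over `[a, +oo[:
   convergence may be only conditional, as for m_integrand below when d = 1. *)
Definition improper_cvg (R : realType) (f : R -> R) (a : R) : Prop :=
  cvg (integral_upto f a b @[b --> +oo]).

Definition improper_integral (R : realType) (f : R -> R) (a : R) : R :=
  lim (integral_upto f a b @[b --> +oo]).

Definition m_integrand (R : realType) (d : nat) (r : R) : R :=
  r `^ (- (d%:R / 2)) * besselJ (d%:R / 2) r.

Definition m (R : realType) (d : nat) (x : R) : R :=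
  2 `^ (d%:R / 2) * Gamma ((d%:R + 1) / 2) / Num.sqrt pi
  * improper_integral (@m_integrand R d) (2 * pi * x).

(* The norm `|xi| of 'rV[R]_d in the library is the sup norm. *)
Definition euclidean_norm (R : realType) (d : nat) (xi : 'rV[R]_d) : R :=
  Num.sqrt (\sum_(i < d) xi ord0 i ^+ 2).

Definition is_max (R : realType) (A : set R) (M : R) : Prop :=
  A M /\ ubound A M.

(* Main.v *)
Require Import Defs.
From HB Require Import structures.
From mathcomp Require Import all_boot all_order all_algebra.
From mathcomp Require Import all_classical all_reals all_analysis.
From mathcomp Require Import measurable_realfun ring lra.

(* With Si y the sine integral, the idea is that m d x = 1 - A (2 pi x), where
   A y is (2 / pi) times an average of the values Si (y s), 0 <= s <= 1: for
   d = 1 the average is the value at s = 1, and for d >= 2 it is taken over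
   s = sin t with the probability density (d - 1) cos^(d - 2) t sin t on
   [0, pi / 2] (Poisson's integral for J_(d/2), integrated by parts). The power
   series of A is computed from that of Si by Wallis' integrals, and
   differentiating it gives that of r^(-d/2) J_(d/2)(r). The theorem then
   follows from 0 <= Si y <= Si pi <= pi and from the Dirichlet integral
   Si y --> pi / 2, both read off the formula
   Si y = pi / 2 - \int_0^(pi / 2) exp(- y cos t) cos (y sin t) dt,
   except for Si y <= Si pi, which holds on [pi, +oo[ because
   Si y + (1 + cos y) / y is nonincreasing there. *)

Set Implicit Arguments.
Unset Strict Implicit.
Unset Printing Implicit Defensive.

Import Order.TTheory GRing.Theory Num.Theory.
Import numFieldNormedType.Exports.

Local Open Scope classical_set_scope.
Local Open Scope ring_scope.

(** * Integrals over segments and limits at infinity *)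

Section calculus.
Context {R : realType}.
Implicit Types (f g F : R -> R) (a b x y : R).
Local Notation mu := (@lebesgue_measure R).

Lemma is_derive_continuous F f : (forall x, is_derive x 1 F (f x)) -> continuous F.
Proof.
move=> dF x; apply: differentiable_continuous; apply/derivable1_diffP.
by case: (dF x).
Qed.

Lemma continuous_integrable f a b :
  continuous f -> mu.-integrable `[a, b] (EFin \o f).
Proof.
move=> cf; apply: continuous_compact_integrable; first exact: segment_compact.
by apply: continuous_subspaceT.
Qed.

Lemma Rintegral_is_derive F f a b : a <= b ->
  continuous f -> continuous F ->
  (forall x, a < x -> is_derive x 1 F (f x)) ->
  \int[mu]_(x in `[a, b]) f x = F b - F a.
Proof.
rewrite le_eqVlt => /predU1P[<-|ab] cf cF dF.
  by rewrite set_itv1 Rintegral_set1 subrr.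
rewrite /Rintegral (@continuous_FTC2 _ _ F)//.
- exact: continuous_subspaceT.
- split.
  + by move=> x /[!in_itv]/= /andP[ax _]; case: (dF x ax).
  + exact/cvg_at_right_filter/cF.
  + exact/cvg_at_left_filter/cF.
- move=> x /[!in_itv]/= /andP[ax _].
  by rewrite derive1E; case: (dF x ax).
Qed.

Lemma is_derive_ge0_le F f a b : a <= b ->
  (forall x, a < x -> is_derive x 1 F (f x)) -> {within `[a, b], continuous F} ->
  (forall x, a < x < b -> 0 <= f x) -> F a <= F b.
Proof.
rewrite le_eqVlt => /predU1P[<-//|ab] dF cF f0.
have [|c cab E] := @MVT _ F f a b ab _ cF.
  by move=> x /[!in_itv]/= /andP[ax _]; exact: dF.
by rewrite -subr_ge0 E mulr_ge0 ?subr_ge0 ?(ltW ab)//; exact: f0.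
Qed.

(** Dominated convergence with a constant majorant. The endpoints form a null set, so pointwise
    convergence is asked on the open interval only: at [t = pi / 2], [Si_kernel y t] is [cos y],
    which has no limit as [y] grows. *)
Lemma bounded_convergence (u : nat -> R -> R) f (C a b : R) :
  (forall n, continuous (u n)) -> continuous f ->
  (forall n x, a <= x <= b -> `|u n x| <= C) ->
  (forall x, a < x < b -> u n x @[n --> \oo] --> f x) ->
  \int[mu]_(x in `[a, b]) u n x @[n --> \oo] --> \int[mu]_(x in `[a, b]) f x.
Proof.
move=> cu cf uC uf.
have oc (h : R -> R) : continuous h ->
    \int[mu]_(x in `[a, b]) h x = \int[mu]_(x in `]a, b[) h x.
  move=> ch; have ih := @continuous_integrable h a b ch.
  rewrite -Rintegral_itv_obnd_cbnd; last first.
    apply: integrableS ih => //; exact: subset_itv_oc_cc.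
  rewrite -Rintegral_itv_bndo_bndc//.
  by apply: integrableS ih => //; exact: subset_itv_oo_cc.
rewrite (oc f)//.
rewrite (_ : (fun n => _) = (fun n => \int[mu]_(x in `]a, b[) u n x)); last first.
  by apply/funext => n; rewrite (oc (u n)).
have mf (h : R -> R) : continuous h -> measurable_fun (`]a, b[ : set R) h.
  by move=> ch; apply: measurable_funTS; exact: continuous_measurable_fun.
have [] := @dominated_convergence _ _ _ mu `]a, b[ (measurable_itv _)
    (fun n => EFin \o u n) (EFin \o f) (EFin \o cst C).
- by move=> n; apply/measurable_EFinP; exact: mf.
- by apply/measurable_EFinP; exact: mf.
- apply: aeW => x /= /[!in_itv]/= xab; apply: cvg_EFin; first exact: nearW.
  exact: uf.
- apply: integrableS (@continuous_integrable (cst C) a b (@cst_continuous _ _ C)) => //.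
  exact: subset_itv_oo_cc.
- apply: aeW => x n /= /[!in_itv]/= /andP[ax xb].
  by rewrite lee_fin uC// !ltW.
move=> int_f _ cv; apply: fine_cvg; rewrite fineK//.
exact: integrable_fin_num.
Qed.

Lemma is_derive_expn f (n : nat) x (df : R) : is_derive x 1 f df ->
  is_derive x 1 (fun x => f x ^+ n) (n%:R * f x ^+ n.-1 * df).
Proof. by move=> /(@is_deriveX _ _ f n x 1 df); rewrite exprfctE. Qed.

(** Dominated convergence works along sequences. A sequence tending to [+oo] eventually equals its
    absolute value, so nonnegative sequences suffice; the formula for [Si] holds on these. *)
Lemma cvgy_ge0_seqP f (l : R) :
  (forall u : R^nat, (forall n, 0 <= u n) -> u @ \oo --> +oo ->
    f (u n) @[n --> \oo] --> l) ->
  f x @[x --> +oo] --> l.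
Proof.
move=> h; apply/cvg_pinftyP => u uy.
have ny : `|u n| @[n --> \oo] --> +oo.
  apply/cvgryPge => A; near=> n; apply: (le_trans _ (ler_norm _)).
  by near: n; move: A; apply/cvgryPge.
have := h (fun n => `|u n|) (fun=> normr_ge0 _) ny.
apply: cvg_trans; apply: near_eq_cvg; near=> n.
rewrite ger0_norm//; near: n.
by move/cvgryPge : uy; exact.
Unshelve. all: by end_near. Qed.

End calculus.

(** * The Gamma function at positive half-integers *)

Section gamma.
Context {R : realType}.
Implicit Types (a v x : R).
Local Notation mu := (@lebesgue_measure R).

(** With an integer [n >= a] and [x >= 1], [x ^ a] is at most [x ^ n], and the Taylor term of degree
    [n + 1] of [expR x] bounds the product by [(n + 1)! / x]. *)
Lemma cvg_powR_expRN a : x `^ a * expR (- x) @[x --> +oo] --> (0 : R).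
Proof.
pose n := (Num.truncn a).+1.
have an : a <= n%:R by rewrite ltW// truncnS_gt.
apply: (@squeeze_cvgr _ _ _ _ (cst 0) (fun x : R => n.+1`!%:R * x^-1)).
- near=> x.
  have x1 : 1 <= x by near: x; exact: nbhs_pinfty_ge.
  have x0 : 0 < x by exact: lt_le_trans x1.
  rewrite /= mulr_ge0 ?powR_ge0 ?expR_ge0//=.
  apply: (@le_trans _ _ (x ^+ n * expR (- x))).
    by rewrite ler_wpM2r ?expR_ge0// -powR_mulrn ?(ltW x0)// ler_powR.
  rewrite expRN ler_pdivrMr ?expR_gt0// mulrAC ler_pdivlMr// -exprSr.
  have := expR_ge1Dxn n (ltW x0).
  have f0 : 0 < n.+1`!%:R :> R by rewrite ltr0n fact_gt0.
  move=> h; have {}h : x ^+ n.+1 / n.+1`!%:R <= expR x.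
    by apply: le_trans h; rewrite lerDr.
  by move: h; rewrite ler_pdivrMr// mulrC.
- exact: cvg_cst.
- rewrite -[X in _ --> X](mulr0 (n.+1`!%:R : R)).
  apply: cvgM; first exact: cvg_cst.
  have /gtr0_cvgV0 : \forall x \near (+oo : set_system R), 0 < (idfun : R -> R) x.
    exact: nbhs_pinfty_gt.
  by move=> [_]; apply; exact: cvg_id.
Unshelve. all: by end_near. Qed.

(* [P] plays the role of the lower incomplete Gamma function, so that the
   values of [Gamma] follow without manipulating integrals. *)
Definition Gamma_primitive a v (P : R -> R) :=
  [/\ P 0 = 0, P x @[x --> 0^'+] --> (0 : R),
      forall x, 0 < x -> is_derive x 1 P (x `^ (a - 1) * expR (- x)) &
      P x @[x --> +oo] --> v].

(** Integration by parts on primitives: subtracting [x ^ a e^(- x)] from [a P] leaves the derivative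
    [x ^ a e^(- x)], and this boundary term vanishes at 0, since [a > 0], and at infinity. *)
Lemma Gamma_primitiveD1 a v P : 0 < a -> Gamma_primitive a v P ->
  Gamma_primitive (a + 1) (a * v) (fun x => a * P x - x `^ a * expR (- x)).
Proof.
move=> a0 [P0 P0r dP Pv]; split.
- by rewrite P0 powR0 ?gt_eqF// mulr0 mul0r subrr.
- rewrite -[X in _ --> X](_ : a * 0 - 0 * expR (- 0) = 0); last by rewrite mulr0 mul0r subrr.
  apply: cvgB; first by apply: cvgM => //; exact: cvg_cst.
  apply: cvgM; first exact: powR_cvg0.
  apply: cvg_at_right_filter; apply: continuous_comp; first exact: opp_continuous.
  exact: continuous_expR.
- move=> x x0; have := dP x x0 => dPx.
  have dE : is_derive x 1 (fun x => expR (- x)) (- expR (- x)).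
    have := @is_derive1_comp _ expR (fun x => - x) x _ _ (is_derive_expR _) _.
    by move=> /(_ _ (is_deriveNid _ _)); rewrite mulrN1.
  have dp := is_derive1_powR a x0.
  apply: is_derive_eq.
  rewrite addrK -[X in _ = X]addr0 /GRing.scale/=; lra.
- rewrite -[X in _ --> X]subr0; apply: cvgB; last exact: cvg_powR_expRN.
  by apply: cvgM => //; exact: cvg_cst.
Qed.

(** The improper fundamental theorem of calculus. The condition [1 <= a] makes the integrand
    continuous up to 0; order 1/2 thus serves only to start the recursion. *)
Lemma Gamma_primitiveE a v P : 1 <= a -> Gamma_primitive a v P -> Gamma a = v.
Proof.
move=> a1 [P0 P0r dP Pv]; rewrite /Gamma /Rintegral.
have cP x : 0 < x -> {for x, continuous (fun x => x `^ (a - 1) * expR (- x))}.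
  move=> x0; have h : {for x, continuous (fun x : R => x `^ (a - 1))}.
    apply: differentiable_continuous; apply/derivable1_diffP.
    by apply: derivable_powR; rewrite in_itv/= x0.
  apply: cvgM; first exact: h.
  by apply: continuous_comp; [exact: opp_continuous|exact: continuous_expR].
rewrite integral_itv_obnd_cbnd; last first.
  apply/measurable_EFinP; apply: open_continuous_measurable_fun => // x.
  by rewrite inE/= in_itv/= andbT => /cP.
rewrite (@ge0_continuous_FTC2y _ _ P 0 v)//.
- by rewrite P0 sube0.
- by move=> x x0; rewrite mulr_ge0 ?powR_ge0 ?expR_ge0.
- apply/continuous_within_itvcyP; split.
    by move=> x; rewrite in_itv/= andbT => /cP.
  apply: cvgM; last first.
    apply: cvg_at_right_filter.
    by apply: continuous_comp; [exact: opp_continuous|exact: continuous_expR].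
  (* For [a = 1] the power is the constant 1, at 0 too; for [a > 1] it tends to its value 0. *)
  move: a1; rewrite -subr_ge0 le_eqVlt => /predU1P[<-|a1].
    by rewrite powRr0; under eq_fun do rewrite powRr0; exact: cvg_cst.
  by rewrite powR0 ?gt_eqF//; exact: powR_cvg0.
- by move=> x x0; case: (dP x x0).
- by rewrite P0.
- by move=> x; rewrite in_itv/= andbT => x0; rewrite derive1E; case: (dP x x0).
Qed.

Lemma Gamma_primitive1 : Gamma_primitive 1 1 (fun x => 1 - expR (- x)).
Proof.
split.
- by rewrite oppr0 expR0 subrr.
- rewrite -[X in _ --> X](_ : 1 - expR (- 0) = 0); last by rewrite oppr0 expR0 subrr.
  apply: cvgB; first exact: cvg_cst.
  apply: cvg_at_right_filter.
  by apply: continuous_comp; [exact: opp_continuous|exact: continuous_expR].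
- move=> x x0.
  have dE : is_derive x 1 (fun x => expR (- x)) (- expR (- x)).
    have := @is_derive1_comp _ expR (fun x => - x) x _ _ (is_derive_expR _) _.
    by move=> /(_ _ (is_deriveNid _ _)); rewrite mulrN1.
  apply: is_derive_eq.
  by rewrite subrr powRr0 mul1r; ring.
- rewrite -[X in _ --> X]subr0; apply: cvgB; first exact: cvg_cst.
  exact: cvgr_expR.
Qed.

(** The square of the integral tends to [pi / 4]; the integral being nonnegative, square roots can
    be taken. *)
Lemma cvg_integral0_gauss :
  \int[mu]_(t in `[0, x]) gauss_fun t @[x --> +oo] --> (Num.sqrt pi / 2 : R).
Proof.
have : Num.sqrt ((\int[mu]_(t in `[0, x]) gauss_fun t) ^+ 2) @[x --> +oo]
    --> (Num.sqrt (pi / 4) : R).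
  apply: (cvg_comp _ _ (@gauss_integral_proof.cvg_integral0_gauss_sqr R)).
  exact: sqrt_continuous.
rewrite sqrtrM ?pi_ge0// (_ : 4^-1 = 2^-1 ^+ 2 :> R); last by field.
rewrite sqrtr_sqr ger0_norm//.
rewrite (_ : (fun _ => Num.sqrt _) = (fun x => \int[mu]_(t in `[0, x]) gauss_fun t))//.
apply/funext => r; rewrite sqrtr_sqr ger0_norm//.
by apply: Rintegral_ge0 => x _; exact: gauss_fun_ge0.
Qed.

(** The substitution [t = s ^ 2] turns the incomplete Gamma integral of order 1/2 into twice a Gauss
    integral up to [Num.sqrt x]. *)
Lemma Gamma_primitive_half : Gamma_primitive 2^-1 (Num.sqrt pi)
  (fun x => 2 * \int[mu]_(t in `[0, Num.sqrt x]) gauss_fun t).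
Proof.
pose H x := \int[mu]_(t in `[0, x]) (gauss_fun t : R).
have ig b : mu.-integrable `[0, b] (EFin \o (@gauss_fun R)).
  exact: continuous_integrable (@continuous_gauss_fun R).
have dH x : 0 < x -> is_derive x 1 H (gauss_fun x).
  move=> x0.
  have [] := @continuous_FTC1_closed _ (@gauss_fun R) 0 x (x + 1) _ (ig _) x0 _.
  - by rewrite ltrDl.
  - exact: continuous_gauss_fun.
  by move=> dH HE; rewrite -HE derive1E; exact: derivableP.
have H0 : H 0 = 0 by rewrite /H set_itv1 Rintegral_set1.
split.
- by rewrite sqrtr0 -/(H 0) H0 mulr0.
- rewrite -[X in _ --> X](mulr0 2); apply: cvgM; first exact: cvg_cst.
  (* The Gauss function is at most 1, so its integral is at most the length [Num.sqrt x]. *)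
  apply: (@squeeze_cvgr _ _ _ _ (cst 0) (@Num.sqrt R)).
  + near=> x; rewrite Rintegral_ge0 => [|t _]; last exact: gauss_fun_ge0.
    rewrite /=.
    have sE : Num.sqrt x = \int[mu]_(t in `[0, Num.sqrt x]) (1 : R).
      rewrite Rintegral_cst//= mul1r lebesgue_measure_itv/= lte_fin.
      case: ifPn => [_|]; first by rewrite oppr0 addr0.
      by rewrite -leNgt => h; apply/eqP; rewrite eq_le sqrtr_ge0 h.
    rewrite [leRHS]sE; apply: le_Rintegral => //.
      by apply: continuous_integrable; exact: cst_continuous.
    by move=> t _; exact: gauss_fun_le1.
  + exact: cvg_cst.
  + rewrite -[X in _ --> X](@sqrtr0 R).
    by apply: cvg_at_right_filter; exact: sqrt_continuous.
- move=> x x0.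
  have s0 : 0 < Num.sqrt x by rewrite sqrtr_gt0.
  have ds := is_derive1_sqrt x0.
  have := is_derive1_comp (dH _ s0) ds => dHs.
  have dHs2 : is_derive x 1 (fun x => 2 * H (Num.sqrt x)) _ := is_deriveZ 2 dHs.
  apply: (is_derive_eq dHs2); rewrite /GRing.scale/=.
  rewrite /gauss_fun sqr_sqrtr ?(ltW x0)// -powR12_sqrt ?(ltW x0)//.
  rewrite (_ : 2^-1 - 1 = - 2^-1 :> R); last by field.
  rewrite powRN invfM; field.
  by rewrite gt_eqF// powR_gt0.
- rewrite -[X in _ --> X](_ : 2 * (Num.sqrt pi / 2) = Num.sqrt pi); last by field.
  apply: cvgM; first exact: cvg_cst.
  apply: (@cvg_comp _ _ _ Num.sqrt H _ +oo); last exact: cvg_integral0_gauss.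
  apply/cvgryPge => A; near=> x.
  by rewrite (le_trans (ler_norm A))// -sqrtr_sqr ler_wsqrtr//; near: x; exact: nbhs_pinfty_ge.
Unshelve. all: by end_near. Qed.

(** Two-step induction: the functional equation raises the order by 1, that is [n] by 2, from the
    orders 1/2 and 1. *)
Lemma ex_Gamma_primitive n : exists v P, 0 < v /\
  Gamma_primitive (n.+1%:R / 2) v P.
Proof.
suff : (exists v P, 0 < v /\ Gamma_primitive (n.+1%:R / 2) v P) /\
    (exists v P, 0 < v /\ Gamma_primitive (n.+2%:R / 2) v P) by case.
elim: n => [|n [[v [P [v0 hP]]] h]]; split => //.
- exists (Num.sqrt pi); eexists; split; first by rewrite sqrtr_gt0 pi_gt0.
  by rewrite mul1r; exact: Gamma_primitive_half.
- by exists 1; eexists; split => //; rewrite divff//; exact: Gamma_primitive1.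
- exists (n.+1%:R / 2 * v); eexists; split; first by rewrite !mulr_gt0.
  rewrite (_ : n.+3%:R / 2 = n.+1%:R / 2 + 1); last by field.
  by apply: Gamma_primitiveD1 hP; rewrite divr_gt0.
Qed.

Lemma Gamma_half_gt0 n : 0 < Gamma (n.+2%:R / 2 : R).
Proof.
have [v [P [v0 hP]]] := ex_Gamma_primitive n.+1.
rewrite (Gamma_primitiveE _ hP)// ler_pdivlMr// mul1r.
by rewrite ler_nat.
Qed.

Lemma Gamma_halfD1 n :
  Gamma (n.+2%:R / 2 + 1 : R) = n.+2%:R / 2 * Gamma (n.+2%:R / 2).
Proof.
have n1 : 1 <= n.+2%:R / 2 :> R by rewrite ler_pdivlMr// mul1r ler_nat.
have n0 : 0 < n.+2%:R / 2 :> R by rewrite divr_gt0.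
have [v [P [v0 hP]]] := ex_Gamma_primitive n.+1.
rewrite (Gamma_primitiveE n1 hP).
rewrite (Gamma_primitiveE _ (Gamma_primitiveD1 n0 hP))//.
by rewrite lerDr ltW.
Qed.

Lemma Gamma1 : Gamma 1 = 1 :> R.
Proof. exact: Gamma_primitiveE (lexx _) Gamma_primitive1. Qed.

Lemma Gamma_3half : Gamma (3 / 2) = Num.sqrt pi / 2 :> R.
Proof.
rewrite (_ : 3 / 2 = 2^-1 + 1); last by field.
rewrite [RHS]mulrC.
apply: (Gamma_primitiveE _ (Gamma_primitiveD1 _ Gamma_primitive_half)) => //.
by rewrite lerDr.
Qed.

End gamma.

(** * Odd entire power series *)

Section odd_entire_series.
Context {R : realType}.
Implicit Types (b : R^nat) (C y z : R).

(** This decay makes the power series entire, dominated by [C * expR |z|], and is preserved by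
    formal differentiation. *)
Definition fact_bounded b C := forall k, `|b k| <= C / k`!%:R.

Lemma normr_pseries_fact_bounded b C z n :
  fact_bounded b C -> `|pseries b z n| <= C * expR `|z|.
Proof.
move=> bC; have C0 : 0 <= C.
  by have := le_trans (normr_ge0 _) (bC 0%N); rewrite fact0 divr1.
apply: (@le_trans _ _ (C * series (exp_coeff `|z|) n)).
  rewrite /series/= mulr_sumr (le_trans (ler_norm_sum _ _ _))//.
  apply: ler_sum => k _; rewrite /exp_coeff/= normrM normrX.
  by rewrite mulrA mulrAC ler_wpM2r ?exprn_ge0// bC.
rewrite ler_wpM2l//; apply: nondecreasing_cvgn_le.
  by apply: nondecreasing_series => k _ _; exact: exp_coeff_ge0.
exact: is_cvg_series_exp_coeff.
Qed.

Lemma is_cvg_pseries_fact_bounded b C z : fact_bounded b C -> cvgn (pseries b z).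
Proof.
move=> bC; have C0 : 0 <= C.
  by have := le_trans (normr_ge0 _) (bC 0%N); rewrite fact0 divr1.
apply: normed_cvg; apply: (@series_le_cvg _ _ (fun k => C * exp_coeff `|z| k)).
- by move=> k /=.
- by move=> k; rewrite mulr_ge0// exp_coeff_ge0.
- move=> k; rewrite /exp_coeff/= normrM normrX.
  by rewrite [leRHS]mulrA [leRHS]mulrAC ler_wpM2r ?exprn_ge0// bC.
- by apply: is_cvg_seriesZ; exact: is_cvg_series_exp_coeff.
Qed.

(** The factor [k + 1] brought down by differentiation is absorbed by [(k + 1)!], so the same [C]
    serves. *)
Lemma fact_bounded_diffs b C : fact_bounded b C -> fact_bounded (pseries_diffs b) C.
Proof.
move=> bC k; rewrite /pseries_diffs normrM ger0_norm//.
rewrite mulrC -ler_pdivlMr//.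
by apply: (le_trans (bC _)); rewrite factS natrM invfM [X in C * X]mulrC mulrA.
Qed.

Lemma is_derive_pseries b C z : fact_bounded b C ->
  is_derive z 1 (fun z => limn (pseries b z)) (limn (pseries (pseries_diffs b) z)).
Proof.
move=> bC; apply: (@pseries_snd_diffs _ _ (`|z| + 1)).
- exact: is_cvg_pseries_fact_bounded bC.
- exact: is_cvg_pseries_fact_bounded (fact_bounded_diffs bC).
- exact: is_cvg_pseries_fact_bounded (fact_bounded_diffs (fact_bounded_diffs bC)).
- by rewrite ltr_normr ltrDl ltr01.
Qed.

(** The series of the [b k * y ^ (2 k + 1)], written through a power series in [y ^ 2] so that the
    results on entire series apply. *)
Definition odd_sum b y := y * limn (pseries b (y ^+ 2)).

Definition odd_sum_derive b y := limn (pseries b (y ^+ 2)) +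
  2 * y ^+ 2 * limn (pseries (pseries_diffs b) (y ^+ 2)).

Lemma is_derive_odd_sum b C y : fact_bounded b C ->
  is_derive y 1 (odd_sum b) (odd_sum_derive b y).
Proof.
move=> bC.
have d2 : is_derive y 1 (fun y => y ^+ 2) (2 * y).
  by apply: is_derive_eq; rewrite /GRing.scale/=; ring.
have := is_derive1_comp (is_derive_pseries _ bC) d2 => dl.
have dl' : is_derive y 1 (fun y => limn (pseries b (y ^+ 2))) _ := dl.
have := is_deriveM (is_derive_id y 1) dl'.
rewrite /odd_sum => h; apply: (is_derive_eq h).
by rewrite /odd_sum_derive /GRing.scale/=; ring.
Qed.

Lemma continuous_odd_sum_derive b C : fact_bounded b C ->
  continuous (odd_sum_derive b).
Proof.
move=> bC.
have cl a : fact_bounded a C -> continuous (fun y => limn (pseries a (y ^+ 2))).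
  move=> aC y; apply: (@continuous_comp _ _ _ (fun y => y ^+ 2) (fun z => limn (pseries a z))).
    exact: exprn_continuous.
  exact: is_derive_continuous (fun z => is_derive_pseries z aC) _.
move=> y; apply: cvgD; first exact: cl.
apply: cvgM; last exact: cl (fact_bounded_diffs bC) _.
apply: cvgM; first exact: cvg_cst.
exact: exprn_continuous.
Qed.

Lemma cvg_odd_sum_derive b C y : fact_bounded b C ->
  pseries (fun k => (2 * k%:R + 1) * b k) (y ^+ 2) @ \oo --> odd_sum_derive b y.
Proof.
move=> bC.
have c1 := @is_cvg_pseries_fact_bounded b C (y ^+ 2) bC.
have c2 := @is_cvg_pseries_fact_bounded _ C (y ^+ 2) (fact_bounded_diffs bC).
have h := cvgD c1 (cvgM (cvg_cst (2 * y ^+ 2)) (pseries_diffs_equiv c2)).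
suff -> : pseries (fun k => (2 * k%:R + 1) * b k) (y ^+ 2) = (fun n =>
    pseries b (y ^+ 2) n + 2 * y ^+ 2 *
    series (fun i => i%:R * b i * (y ^+ 2) ^+ i.-1) n) by exact: h.
apply/funext => n.
rewrite /pseries /series/= mulr_sumr -big_split/=.
(* The index 0 is separate because [0.-1] is 0; its second term carries the factor 0. *)
apply: eq_bigr => -[|k] _; first by rewrite /=; ring.
by rewrite /=; move: (y ^+ 2) => z; rewrite exprS; ring.
Qed.

Lemma cvg_odd_sum b C y : fact_bounded b C ->
  series (fun k => b k * y ^+ k.*2.+1) @ \oo --> odd_sum b y.
Proof.
move=> bC.
have c1 := @is_cvg_pseries_fact_bounded b C (y ^+ 2) bC.
have h := cvgM (cvg_cst y) c1.
suff -> : series (fun k => b k * y ^+ k.*2.+1) =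
    (fun n => y * pseries b (y ^+ 2) n) by exact: h.
apply/funext => n.
rewrite /pseries /series/= mulr_sumr.
by apply: eq_bigr => k _; rewrite -exprM mul2n exprS mulrCA.
Qed.

(** Uniform in [n], this is the majorant for integrating the series of [Si (y * sin t)] term by
    term. *)
Lemma normr_odd_series b C y n : fact_bounded b C ->
  `|series (fun k => b k * y ^+ k.*2.+1) n| <= `|y| * (C * expR (y ^+ 2)).
Proof.
move=> bC.
have -> : series (fun k => b k * y ^+ k.*2.+1) n = y * pseries b (y ^+ 2) n.
  rewrite /pseries /series/= mulr_sumr.
  by apply: eq_bigr => k _; rewrite -exprM mul2n exprS mulrCA.
rewrite normrM ler_wpM2l//.
by apply: le_trans (normr_pseries_fact_bounded _ _ bC) _; rewrite ger0_norm ?sqr_ge0.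
Qed.

End odd_entire_series.

(** * The sine integral *)

Section sine_integral.
Context {R : realType}.
Implicit Types (x y : R).
Local Notation mu := (@lebesgue_measure R).

Definition Si_coef : R^nat := fun k =>
  (-1) ^+ k / ((2 * k%:R + 1) * k.*2.+1`!%:R).

(** As sums of power series, [Si] and its derivative [sinc] are regular at 0, where [sinc] is 1;
    [mul_sinc] ties [sinc] to [sin] without a division. *)
Definition Si : R -> R := odd_sum Si_coef.
Definition sinc : R -> R := odd_sum_derive Si_coef.

Lemma Si_coef_bounded : fact_bounded Si_coef 1.
Proof.
move=> k; rewrite /Si_coef normrM normrX normrN1 expr1n !mul1r normfV.
have k1 : 1 <= 2 * k%:R + 1 :> R by rewrite lerDr mulr_ge0.
have f0 n : 0 < n`!%:R :> R by rewrite ltr0n fact_gt0.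
have p0 : 0 < (2 * k%:R + 1) * k.*2.+1`!%:R :> R.
  by rewrite mulr_gt0// (lt_le_trans _ k1).
rewrite ger0_norm ?(ltW p0)// lef_pV2 ?posrE//.
apply: (@le_trans _ _ (k.*2.+1`!%:R)).
  by rewrite ler_nat; apply: leq_fact; rewrite -addnn -addnS leq_addr.
by rewrite ler_peMl// ltW.
Qed.

Lemma is_derive_Si y : is_derive y 1 Si (sinc y).
Proof. exact: is_derive_odd_sum Si_coef_bounded. Qed.

Lemma continuous_Si : continuous Si.
Proof. exact: is_derive_continuous is_derive_Si. Qed.

Lemma continuous_sinc : continuous sinc.
Proof. exact: continuous_odd_sum_derive Si_coef_bounded. Qed.

Lemma Si0 : Si 0 = 0. Proof. by rewrite /Si /odd_sum mul0r. Qed.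

Lemma mul_sinc y : y * sinc y = sin y.
Proof.
have h : series (sin_coeff' y) @ \oo --> y * sinc y.
  suff -> : series (sin_coeff' y) =
      cst y \* pseries (fun k => (2 * k%:R + 1) * Si_coef k) (y ^+ 2).
    by apply: cvgM; [exact: cvg_cst|exact: cvg_odd_sum_derive Si_coef_bounded].
  apply/funext => n; rewrite /pseries /series/= mulr_sumr; apply: eq_bigr => k _.
  rewrite /sin_coeff' /Si_coef -exprM mul2n exprS.
  rewrite -[(-1) ^ k]/((-1) ^+ k); field.
  rewrite pnatr_eq0 -lt0n fact_gt0/=.
  by rewrite gt_eqF// ltr_wpDl// mulr_ge0.
by rewrite -(cvg_lim _ h)// (cvg_lim _ (@cvg_sin_coeff' R y)).
Qed.

Definition Si_kernel (y t : R) : R := expR (- y * cos t) * cos (y * sin t).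

(** For [y > 0], the imaginary part of the integral of [e^(i z) / z] over the quarter circle of
    radius [y], the angle [t] being measured from the imaginary axis. *)
Definition Si_remainder (y : R) : R :=
  \int[mu]_(t in `[0, pi / 2]) Si_kernel y t.

Lemma cos_ge0_quarter (t : R) : 0 <= t <= pi / 2 -> 0 <= cos t.
Proof.
move=> /andP[t0 tp]; apply: cos_ge0_pihalf; rewrite tp andbT (le_trans _ t0)//.
by rewrite oppr_le0 divr_ge0// pi_ge0.
Qed.

Lemma sin_ge0_quarter (t : R) : 0 <= t <= pi / 2 -> 0 <= sin t.
Proof.
move=> /andP[t0 tp]; apply: sin_ge0_pi; rewrite t0 (le_trans tp)//.
by rewrite ler_pdivrMr// ler_peMr ?pi_ge0// ler1n.
Qed.

Lemma continuous_Si_kernel y : continuous (Si_kernel y).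
Proof.
move=> t; apply: cvgM.
  apply: continuous_comp; last exact: continuous_expR.
  by apply: cvgM; [exact: cvg_cst|exact: continuous_cos].
apply: continuous_comp; last exact: continuous_cos.
by apply: cvgM; [exact: cvg_cst|exact: continuous_sin].
Qed.

Lemma normr_Si_kernel y t : 0 <= y -> 0 <= t <= pi / 2 -> `|Si_kernel y t| <= expR (- (y * cos t)).
Proof.
move=> y0 tpi; rewrite /Si_kernel normrM ger0_norm ?expR_ge0// mulNr.
by rewrite ler_piMr ?expR_ge0// cos_max.
Qed.

Lemma normr_Si_kernel_le1 y t : 0 <= y -> 0 <= t <= pi / 2 -> `|Si_kernel y t| <= 1.
Proof.
move=> y0 tpi; apply: (le_trans (normr_Si_kernel y0 tpi)).
by rewrite expR_le1 oppr_le0 mulr_ge0// cos_ge0_quarter.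
Qed.

Lemma normr_Si_remainder y : 0 <= y -> `|Si_remainder y| <= pi / 2.
Proof.
move=> y0; have ik := @continuous_integrable R _ 0 (pi / 2) (@continuous_Si_kernel y).
apply: (le_trans (le_normr_Rintegral _ ik)) => //.
apply: (@le_trans _ _ (\int[mu]_(t in `[0, pi / 2]) (1 : R))); last first.
  rewrite Rintegral_cst//= mul1r lebesgue_measure_itv/= lte_fin.
  by rewrite divr_gt0 ?pi_gt0//= oppr0 addr0.
apply: le_Rintegral => //.
- exact: (integrable_norm ik).
- by apply: continuous_integrable; exact: cst_continuous.
- by move=> t /=; rewrite in_itv/= => /(normr_Si_kernel_le1 y0).
Qed.

(** Dominated convergence with majorant 1: for [0 < t < pi / 2], [cos t] is positive and
    [exp(- y cos t)] tends to 0. *)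
Lemma cvg_Si_remainder : Si_remainder y @[y --> +oo] --> (0 : R).
Proof.
apply: cvgy_ge0_seqP => u u0 uy.
rewrite -[X in _ --> X](_ : \int[mu]_(t in `[0, pi / 2]) (cst 0 t : R) = 0); last first.
  by rewrite Rintegral_cst//= mul0r.
apply: (@bounded_convergence _ _ _ 1).
- by move=> n; exact: continuous_Si_kernel.
- exact: cst_continuous.
- by move=> n t; exact: normr_Si_kernel_le1.
- move=> t /andP[t0 tp].
  have c0 : 0 < cos t.
    rewrite cos_gt0_pihalf// tp andbT (lt_trans _ t0)//.
    by rewrite oppr_lt0 divr_gt0// pi_gt0.
  apply: norm_cvg0.
  apply: (@squeeze_cvgr _ _ _ _ (cst 0) (fun n => expR (- (u n * cos t)))).
  + near=> n; rewrite normr_ge0/=; apply: normr_Si_kernel => //.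
    by rewrite !ltW.
  + exact: cvg_cst.
  + have cu : u n * cos t @[n --> \oo] --> +oo.
      apply/cvgryPge => A; near=> n; rewrite -ler_pdivrMr//.
      by near: n; move/cvgryPge : uy; exact.
    exact: (cvg_comp _ _ cu (@cvgr_expR R)).
Unshelve. all: by end_near. Qed.

Definition Si_kernel_derive (y t : R) :=
  - (expR (- y * cos t) * (cos t * cos (y * sin t) + sin t * sin (y * sin t))).

Lemma is_derive_Si_kernel (t y : R) :
  is_derive y 1 (Si_kernel ^~ t) (Si_kernel_derive y t).
Proof.
have d1 : is_derive y 1 (fun y => - y * cos t) (- cos t).
  by apply: is_derive_eq; rewrite /GRing.scale/=; ring.
have d2 : is_derive y 1 (fun y => y * sin t) (sin t).
  by apply: is_derive_eq; rewrite /GRing.scale/=; ring.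
have e1 : is_derive y 1 (fun y => expR (- y * cos t)) _ :=
  is_derive1_comp (is_derive_expR _) d1.
have e2 : is_derive y 1 (fun y => cos (y * sin t)) _ :=
  is_derive1_comp (is_derive_cos _) d2.
apply: (is_derive_eq (is_deriveM e1 e2)).
by rewrite /Si_kernel_derive /GRing.scale/=; ring.
Qed.

(* [Si_kernel y t] is the real part of exp(- y e^(- i t)); its derivative in [y]
   is proportional to the derivative in [t] of the imaginary part. *)
Lemma is_derive_Si_kernel_angle (y t : R) :
  is_derive t 1 (fun t => expR (- y * cos t) * sin (y * sin t))
    (- y * Si_kernel_derive y t).
Proof.
have d1 : is_derive t 1 (fun t => - y * cos t) (y * sin t).
  by apply: is_derive_eq; rewrite /GRing.scale/=; ring.
have d2 : is_derive t 1 (fun t => y * sin t) (y * cos t).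
  by apply: is_derive_eq; rewrite /GRing.scale/=; ring.
have e1 : is_derive t 1 (fun t => expR (- y * cos t)) _ :=
  is_derive1_comp (is_derive_expR _) d1.
have e2 : is_derive t 1 (fun t => sin (y * sin t)) _ :=
  is_derive1_comp (is_derive_sin _) d2.
apply: (is_derive_eq (is_deriveM e1 e2)).
by rewrite /Si_kernel_derive /GRing.scale/=; ring.
Qed.

Lemma continuous_Si_kernel_derive y : continuous (Si_kernel_derive y).
Proof.
move=> t; apply: cvgN; apply: cvgM.
  apply: continuous_comp; last exact: continuous_expR.
  by apply: cvgM; [exact: cvg_cst|exact: continuous_cos].
apply: cvgD; apply: cvgM.
- exact: continuous_cos.
- apply: continuous_comp; last exact: continuous_cos.
  by apply: cvgM; [exact: cvg_cst|exact: continuous_sin].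
- exact: continuous_sin.
- apply: continuous_comp; last exact: continuous_sin.
  by apply: cvgM; [exact: cvg_cst|exact: continuous_sin].
Qed.

(** For [y > -1] the exponent [- y cos t] is at most 1, whence [expR 1]. Going below 0 gives room to
    differentiate the remainder at 0 itself, and so to have its continuity there. *)
Lemma normr_Si_kernel_derive (y t : R) : -1 < y -> 0 <= t <= pi / 2 ->
  `|Si_kernel_derive y t| <= 2 * expR 1.
Proof.
move=> y1 tpi; rewrite normrN normrM mulrC ler_pM//.
  rewrite (le_trans (ler_normD _ _))// !normrM [leRHS](_ : 2 = 1 * 1 + 1 * 1); last by ring.
  by rewrite lerD// ler_pM// ?cos_max ?sin_max.
rewrite ger0_norm ?expR_ge0// ler_expR.
have c0 := cos_ge0_quarter tpi; have c1 := cos_le1 t; nra.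
Qed.

(** Differentiation under the integral sign, on the neighbourhood []-1, y + 1[] of [y], with the
    constant majorant just found. *)
Lemma is_derive_Si_remainder y : -1 < y -> is_derive y 1 Si_remainder
  (\int[mu]_(t in `[0, pi / 2]) Si_kernel_derive y t).
Proof.
move=> y1.
have yI : (`]-1, y + 1[ : set R)%classic y by rewrite /= in_itv/= y1 ltrDl ltr01.
have pE x t : partial1of2 Si_kernel x t = Si_kernel_derive x t.
  by rewrite partial1of2E; case: (is_derive_Si_kernel t x).
have h1 x : (`]-1, y + 1[ : set R)%classic x ->
    mu.-integrable `[0, pi / 2] (EFin \o Si_kernel x).
  by move=> _; apply: continuous_integrable; exact: continuous_Si_kernel.
have h2 x t : (`]-1, y + 1[ : set R)%classic x -> (`[0, pi / 2] : set R)%classic t ->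
    derivable (Si_kernel ^~ t) x 1.
  by move=> _ _; case: (is_derive_Si_kernel t x).
have h3 : mu.-integrable `[0, pi / 2] (EFin \o (cst (2 * expR 1))).
  by apply: continuous_integrable; exact: cst_continuous.
have h4 x t : (`]-1, y + 1[ : set R)%classic x -> (`[0, pi / 2] : set R)%classic t ->
    `|partial1of2 Si_kernel x t| <= cst (2 * expR 1) t.
  rewrite /= !in_itv/= pE => /andP[x1 _] tpi.
  exact: normr_Si_kernel_derive.
have C0 (t : R) : 0 <= cst (2 * expR 1) t :> R by rewrite mulr_ge0// expR_ge0.
have mB : measurable (`[0, pi / 2] : set R) by [].
split.
  exact: (@derivable_under_integral R _ _ mu Si_kernel _ mB _ _ _ yI h1 h2 _ C0 h3 h4).
rewrite -derive1E.
rewrite [LHS](@differentiation_under_integral R _ _ mu Si_kernel _ mB _ _ _ yI h1 h2 _ C0 h3 h4).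
by apply: eq_Rintegral => t _; rewrite -pE.
Qed.

(** Multiplied by [- y], the integrand becomes the derivative in [t] of [K], which is 0 at 0 and
    [sin y] at [pi / 2]. *)
Lemma integral_Si_kernel_derive y : y != 0 ->
  \int[mu]_(t in `[0, pi / 2]) Si_kernel_derive y t = - sinc y.
Proof.
move=> y0.
have ck := @continuous_Si_kernel_derive y.
have hE : - y * \int[mu]_(t in `[0, pi / 2]) Si_kernel_derive y t = sin y.
  rewrite -RintegralZl//; last exact: continuous_integrable.
  pose K t := expR (- y * cos t) * sin (y * sin t).
  transitivity (K (pi / 2) - K 0); last first.
    by rewrite /K cos_pihalf sin_pihalf sin0 !mulr0 expR0 sin0 mulr0 subr0 mul1r mulr1.
  apply: Rintegral_is_derive.
  - by rewrite divr_ge0// pi_ge0.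
  - by move=> t; apply: cvgM; [exact: cvg_cst|exact: ck].
  - exact: is_derive_continuous (@is_derive_Si_kernel_angle y).
  - by move=> t _; exact: is_derive_Si_kernel_angle.
apply: (mulfI y0); rewrite mulrN mul_sinc -hE; ring.
Qed.

(** [Si + Si_remainder] has zero derivative on the positive axis and is continuous at 0, where its
    value is [pi / 2]. *)
Lemma Si_remainderE y : 0 <= y -> Si y = pi / 2 - Si_remainder y.
Proof.
move=> y0; apply/eqP; rewrite eq_sym subr_eq eq_sym; apply/eqP.
have G0 : Si_remainder 0 = pi / 2.
  rewrite /Si_remainder (@eq_Rintegral _ _ _ mu _ (cst 1)); last first.
    by move=> t _; rewrite /Si_kernel oppr0 !mul0r expR0 cos0 mul1r.
  rewrite Rintegral_cst//= mul1r lebesgue_measure_itv/= lte_fin.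
  by rewrite divr_gt0 ?pi_gt0//= oppr0 addr0.
have := @MVT_segment R (Si \+ Si_remainder) (cst 0) 0 y y0 _ _.
case.
- move=> x; rewrite in_itv/= => /andP[x0 _].
  have d1 := is_derive_Si x.
  have d2 : is_derive x 1 Si_remainder (- sinc x).
    rewrite -integral_Si_kernel_derive ?gt_eqF//.
    by apply: is_derive_Si_remainder; rewrite (lt_trans _ x0).
  by apply: (is_derive_eq (is_deriveD d1 d2)); rewrite subrr.
- apply: derivable_within_continuous => x; rewrite in_itv/= => /andP[x0 _].
  apply: derivableD; first by case: (is_derive_Si x).
  by case: (@is_derive_Si_remainder x); rewrite ?(lt_le_trans _ x0).
- move=> c _; rewrite mul0r => /eqP; rewrite subr_eq0 => /eqP/= ->.
  by rewrite Si0 add0r G0.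
Qed.

Lemma Si_ge0 y : 0 <= y -> 0 <= Si y.
Proof.
move=> y0; rewrite Si_remainderE// subr_ge0.
exact: le_trans (ler_norm _) (normr_Si_remainder y0).
Qed.

(** This crude bound yields [profile <= 2], that is [m >= -1], and is the majorant in
    [cvg_profile]. *)
Lemma Si_le_pi y : 0 <= y -> Si y <= pi.
Proof.
move=> y0; rewrite Si_remainderE//.
have := le_trans (ler_norm _) (normr_Si_remainder y0).
have := normr_Si_remainder y0; rewrite ler_norml => /andP[+ _]; lra.
Qed.

Lemma cvg_Si : Si y @[y --> +oo] --> (pi / 2 : R).
Proof.
apply: cvgy_ge0_seqP => u u0 uy.
rewrite (_ : (fun n => Si (u n)) = (fun n => pi / 2 - Si_remainder (u n))); last first.
  by apply/funext => n; exact: Si_remainderE.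
rewrite -[X in _ --> X]subr0; apply: cvgB; first exact: cvg_cst.
exact: (cvg_comp _ _ uy cvg_Si_remainder).
Qed.

Lemma Si_le_Si_pi y : 0 <= y -> Si y <= Si pi.
Proof.
move=> y0; have [ypi|/ltW piy] := leP y pi.
  apply: (is_derive_ge0_le ypi (fun x _ => is_derive_Si x)).
    exact/continuous_subspaceT/continuous_Si.
  move=> x /andP[yx xpi]; have x0 : 0 < x by exact: le_lt_trans yx.
  rewrite -(pmulr_rge0 _ x0) mul_sinc sin_ge0_pi//.
  by rewrite !ltW.
(* Differentiating [(1 + cos x) / x] produces [- sin x / x], which cancels the derivative of [Si]
   and leaves a term of constant sign. The 1 makes the added term nonnegative, and zero at [pi]. *)
pose F x := - (Si x + (1 + cos x) / x).
have dF x : 0 < x -> is_derive x 1 F ((1 + cos x) / x ^+ 2).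
  move=> x0; have d1 := is_derive_Si x.
  have d2 : is_derive x 1 (fun x => x^-1) _ :=
    is_deriveV (lt0r_neq0 x0) (is_derive_id x 1).
  have d3 : is_derive x 1 (fun x => 1 + cos x) (- sin x).
    by apply: is_derive_eq; ring.
  have d4 := is_deriveN (is_deriveD d1 (is_deriveM d3 d2)).
  apply: (is_derive_eq d4); rewrite /GRing.scale/= -(mul_sinc x); field.
  by rewrite gt_eqF.
have pi0 : 0 < pi :> R := pi_gt0 R.
have : F pi <= F y.
  apply: (is_derive_ge0_le piy).
  - by move=> x pix; exact: dF (lt_trans pi0 pix).
  - apply: derivable_within_continuous => x; rewrite in_itv/= => /andP[pix _].
    have [dFx _] := dF x (lt_le_trans pi0 pix).  exact: dFx.
  - by move=> x _; rewrite mulr_ge0 ?invr_ge0 ?sqr_ge0.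
rewrite lerN2 cospi addrN mul0r addr0; apply: le_trans.
by rewrite lerDl divr_ge0.
Qed.

(** At [s = 0] the quotient is 0 by the convention on division while [sinc] is 1; passing to []0,
    pi]] removes that point. *)
Lemma Rintegral_sin_div : \int[mu]_(s in `[0, pi]) (sin s / s) = Si pi.
Proof.
have -> : Si pi = \int[mu]_(s in `[0, pi]) sinc s.
  rewrite -[LHS]subr0 -[X in _ - X]Si0; apply/esym/Rintegral_is_derive.
  - exact: pi_ge0.
  - exact: continuous_sinc.
  - exact: continuous_Si.
  - by move=> x _; exact: is_derive_Si.
have e s : s \in (`]0, pi] : set R)%classic -> sin s / s = sinc s.
  rewrite inE/= in_itv/= => /andP[s0 _].
  by rewrite -(mul_sinc s) mulrAC mulfV ?mul1r// gt_eqF.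
have isc := @continuous_integrable R _ 0 pi continuous_sinc.
have isc' : mu.-integrable `]0, pi] (EFin \o sinc).
  by apply: integrableS isc => //; exact: subset_itv_oc_cc.
rewrite -[RHS]Rintegral_itv_obnd_cbnd//.
rewrite -[LHS]Rintegral_itv_obnd_cbnd; last first.
  apply: eq_integrable isc' => // s sI /=; congr EFin.
  by rewrite e.
exact: eq_Rintegral.
Qed.

End sine_integral.

(** * Wallis integrals and averages of the sine integral *)

Section moments.
Context {R : realType}.
Implicit Types (x y t : R) (n p q k : nat).
Local Notation mu := (@lebesgue_measure R).

Definition trig_moment p q : R :=
  \int[mu]_(t in `[0, pi / 2]) (cos t ^+ p * sin t ^+ q).

Lemma pihalf_ge0 : 0 <= pi / 2 :> R.
Proof. by rewrite divr_ge0// pi_ge0. Qed.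

Lemma continuous_cosX_sinX p q : continuous (fun t : R => cos t ^+ p * sin t ^+ q).
Proof.
move=> t; apply: cvgM.
  by apply: (@continuous_comp _ _ _ (@cos R) (fun x => x ^+ p));
    [exact: continuous_cos|exact: exprn_continuous].
by apply: (@continuous_comp _ _ _ (@sin R) (fun x => x ^+ q));
  [exact: continuous_sin|exact: exprn_continuous].
Qed.

Lemma integrable_cosX_sinX p q :
  mu.-integrable `[0, pi / 2] (EFin \o (fun t : R => cos t ^+ p * sin t ^+ q)).
Proof. exact: continuous_integrable (@continuous_cosX_sinX p q). Qed.

Lemma trig_moment_sum p q :
  trig_moment p.+2 q + trig_moment p q.+2 = trig_moment p q.
Proof.
rewrite /trig_moment -RintegralD//; [|exact: integrable_cosX_sinX..].
apply: eq_Rintegral => t _.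
rewrite -addn2 -[q.+2]addn2 !exprD mulrAC mulrA -mulrDr cos2Dsin2 mulr1//.
Qed.

(** The difference of the two sides integrates the derivative of [cos^(p+1) sin^(q+1)], which
    vanishes at both ends. *)
Lemma trig_moment_shift p q :
  q.+1%:R * trig_moment p.+2 q = p.+1%:R * trig_moment p q.+2.
Proof.
apply/eqP; rewrite -subr_eq0 /trig_moment -!RintegralZl//; [|exact: integrable_cosX_sinX..].
have cc (c : R) p' q' : continuous (fun t : R => c * (cos t ^+ p' * sin t ^+ q')).
  by move=> t; apply: cvgM; [exact: cvg_cst|exact: continuous_cosX_sinX].
rewrite -RintegralB//; [|exact: continuous_integrable..].
pose K t : R := cos t ^+ p.+1 * sin t ^+ q.+1.
apply/eqP; transitivity (K (pi / 2) - K 0); last first.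
  by rewrite /K cos_pihalf sin0 !expr0n/= mul0r mulr0 subr0.
apply: Rintegral_is_derive.
- exact: pihalf_ge0.
- by move=> t; apply: cvgB; exact: cc.
- exact: continuous_cosX_sinX.
move=> t _.
have d1 : is_derive t 1 (fun t : R => cos t ^+ p.+1) (- (p.+1%:R * cos t ^+ p * sin t)).
  by apply: (is_derive_eq (is_derive_expn p.+1 (is_derive_cos t))); rewrite /=; ring.
have d2 : is_derive t 1 (fun t : R => sin t ^+ q.+1) (q.+1%:R * sin t ^+ q * cos t).
  by apply: (is_derive_eq (is_derive_expn q.+1 (is_derive_sin t))).
apply: (is_derive_eq (is_deriveM d1 d2)).
by rewrite /GRing.scale/= !exprS; ring.
Qed.

(** The sum and shift relations are a linear system for the two raised moments; this lemma and
    [trig_moment_cos_step] solve it. *)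
Lemma trig_moment_sin_step p q :
  trig_moment p q.+2 = q.+1%:R / (p + q).+2%:R * trig_moment p q.
Proof.
have s := trig_moment_shift p q; have := trig_moment_sum p q => <-.
have e : (p + q).+2%:R = p.+1%:R + q.+1%:R :> R by rewrite -natrD addSn addnS.
have e0 : p.+1%:R + q.+1%:R != 0 :> R by rewrite -e pnatr_eq0.
apply: (mulfI e0); rewrite e mulrA mulrCA divff// mulr1 mulrDr s; ring.
Qed.

Lemma trig_moment_cos_step p q :
  trig_moment p.+2 q = p.+1%:R / (p + q).+2%:R * trig_moment p q.
Proof.
have := trig_moment_sum p q; rewrite trig_moment_sin_step => h.
have e : (p + q).+2%:R = p.+1%:R + q.+1%:R :> R by rewrite -natrD addSn addnS.
have e0 : p.+1%:R + q.+1%:R != 0 :> R by rewrite -e pnatr_eq0.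
apply: (addIr (q.+1%:R / (p + q).+2%:R * trig_moment p q)); rewrite h e.
by rewrite -mulrDl -mulrDl divff// mul1r.
Qed.

(** The density [(p + 1) cos^p t sin t] that averages [Si] has total mass 1; its primitive is
    [- cos^(p+1)]. *)
Lemma trig_moment_sin_prim p : p.+1%:R * trig_moment p 1 = 1.
Proof.
rewrite /trig_moment -RintegralZl//; last exact: integrable_cosX_sinX.
pose K t : R := - cos t ^+ p.+1.
transitivity (K (pi / 2) - K 0); last first.
  by rewrite /K cos_pihalf cos0 expr0n/= expr1n oppr0 opprK add0r.
apply: Rintegral_is_derive.
- exact: pihalf_ge0.
- by move=> t; apply: cvgM; [exact: cvg_cst|exact: continuous_cosX_sinX].
- move=> t; apply: cvgN; apply: (@continuous_comp _ _ _ (@cos R) (fun x => x ^+ p.+1)).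
    exact: continuous_cos.
  exact: exprn_continuous.
- move=> t _.
  apply: (is_derive_eq (is_deriveN (is_derive_expn p.+1 (is_derive_cos t)))).
  by rewrite /= expr1; ring.
Qed.

(** With [d = n.+1] this is the factor [Gamma ((d + 1) / 2)] of [m]; the argument is always at least
    1. *)
Definition Gamma_half n : R := Gamma (n.+2%:R / 2).

Lemma Gamma_half_step n : Gamma_half n.+2 = n.+2%:R / 2 * Gamma_half n.
Proof. by rewrite /Gamma_half -Gamma_halfD1; congr Gamma; field. Qed.

Lemma Gamma_half_neq0 n : Gamma_half n != 0.
Proof. by rewrite gt_eqF// Gamma_half_gt0. Qed.

Lemma Gamma_half0 : Gamma_half 0 = 1.
Proof. by rewrite /Gamma_half divff// Gamma1. Qed.

Lemma Gamma_half1 : Gamma_half 1 = Num.sqrt pi / 2.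
Proof. exact: Gamma_3half. Qed.

Lemma sqrtpi_neq0 : Num.sqrt pi != 0 :> R.
Proof. by rewrite gt_eqF// sqrtr_gt0 pi_gt0. Qed.

(** The Wallis recursion raises the exponent by 2, so the induction carries two consecutive cases,
    starting from the exponents 1 and 2. *)
Lemma trig_moment_cosE n :
  trig_moment n.+1 0 = Num.sqrt pi / 2 * Gamma_half n / Gamma_half n.+1.
Proof.
have spi := sqrtpi_neq0.
suff : trig_moment n.+1 0 = Num.sqrt pi / 2 * Gamma_half n / Gamma_half n.+1 /\
  trig_moment n.+2 0 = Num.sqrt pi / 2 * Gamma_half n.+1 / Gamma_half n.+2 by case.
elim: n => [|n [IH1 IH2]]; split => //.
- rewrite Gamma_half0 Gamma_half1 mulr1 divff ?mulf_neq0//.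
  transitivity (sin (pi / 2) - sin 0 : R); last by rewrite sin_pihalf sin0 subr0.
  rewrite /trig_moment; apply: Rintegral_is_derive.
  + exact: pihalf_ge0.
  + exact: continuous_cosX_sinX.
  + exact: continuous_sin.
  + by move=> t _; apply: is_derive_eq; rewrite expr1 expr0 mulr1.
- rewrite trig_moment_cos_step Gamma_half_step Gamma_half0 Gamma_half1.
  have -> : trig_moment 0 0 = pi / 2.
    rewrite /trig_moment (@eq_Rintegral _ _ _ mu _ (cst 1)); last first.
      by move=> t _; rewrite !expr0 mulr1.
    rewrite Rintegral_cst//= mul1r lebesgue_measure_itv/= lte_fin.
    by rewrite divr_gt0 ?pi_gt0//= oppr0 addr0.
  have spp : Num.sqrt pi * Num.sqrt pi = pi :> R by rewrite -expr2 sqr_sqrtr// pi_ge0.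
  by rewrite -[in LHS]spp; field.
- rewrite trig_moment_cos_step IH1 Gamma_half_step [in RHS]Gamma_half_step addn0.
  have g0 := Gamma_half_neq0 n; have g1 := Gamma_half_neq0 n.+1.
  have n3 : n.+3%:R != 0 :> R by rewrite pnatr_eq0.
  move: n3 g0 g1.
  move: (n.+3%:R : R) (n.+2%:R : R) (Gamma_half n) (Gamma_half n.+1) => a b c e a0 c0 e0.
  by field; rewrite a0 e0.
Qed.

(* With [d = n.+1], the moment of order [2 * k + 1] of the probability law that
   averages [Si]. *)
Definition ball_moment n k : R :=
  Num.sqrt pi / 2 * Gamma_half n * k.*2.+1`!%:R /
  (Gamma_half (k.*2 + n).+1 * k`!%:R * 4 ^+ k).

Lemma ball_moment_step n k :
  ball_moment n k.+1 = k.*2.+3%:R / (k.*2 + n).+3%:R * ball_moment n k.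
Proof.
rewrite /ball_moment doubleS addSn addSn Gamma_half_step.
rewrite (factS k.*2.+2) (factS k.*2.+1) (factS k) !natrM exprS.
have g0 := Gamma_half_neq0 (k.*2 + n).+1.
have f0 : k`!%:R != 0 :> R by rewrite pnatr_eq0 -lt0n fact_gt0.
have e0 : 4 ^+ k != 0 :> R by rewrite expf_neq0.
have -> : k.*2.+2%:R = 2 * k.+1%:R :> R by rewrite -doubleS -mul2n natrM.
have k0 : k.+1%:R != 0 :> R by rewrite pnatr_eq0.
have n0 : (k.*2 + n).+3%:R != 0 :> R by rewrite pnatr_eq0.
move: k0 n0 g0 f0 e0 (k.*2.+3%:R : R) (k.*2.+1`!%:R : R).
move: (k.+1%:R : R) ((k.*2 + n).+3%:R : R) (Gamma_half _) (k`!%:R : R) (4 ^+ k).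
move=> a b c d e a0 b0 c0 d0 e0 u v.
by field; rewrite a0 b0 c0 d0 e0.
Qed.

(** For [d = 1] the law is the point mass at 1. *)
Lemma ball_moment_interval k : ball_moment 0 k = 1.
Proof.
elim: k => [|k IH].
  rewrite /ball_moment Gamma_half0 Gamma_half1 /= fact0 !mulr1.
  by rewrite divff// mulf_neq0// sqrtpi_neq0.
by rewrite ball_moment_step IH addn0 mulr1 divff// pnatr_eq0.
Qed.

(** Both sides obey the same recursion in [k]. The exponent is [2 k + 2] because the density
    contributes one more sine to [sin^(2k+1)]. *)
Lemma ball_momentE p k :
  ball_moment p.+1 k = p.+1%:R * trig_moment p k.*2.+2.
Proof.
elim: k => [|k IH].
  rewrite /ball_moment /= fact0 !mulr1 add0n -trig_moment_cosE.
  by rewrite -trig_moment_shift mul1r.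
rewrite ball_moment_step IH doubleS [in RHS]trig_moment_sin_step mulrCA.
by rewrite !addnS [in RHS](addnC p).
Qed.

Lemma ball_moment_gt0 n k : 0 < ball_moment n k.
Proof.
rewrite /ball_moment divr_gt0//.
  by rewrite !mulr_gt0 ?invr_gt0 ?sqrtr_gt0 ?pi_gt0 ?Gamma_half_gt0// ltr0n fact_gt0.
by rewrite !mulr_gt0 ?Gamma_half_gt0 ?exprn_gt0// ltr0n fact_gt0.
Qed.

(** Moments of a law carried by [[0, 1]] decrease: the ratio of consecutive ones is at most 1. *)
Lemma ball_moment_le n k : ball_moment n k <= ball_moment n 0.
Proof.
elim: k => // k; apply: le_trans.
rewrite ball_moment_step ler_piMl ?(ltW (ball_moment_gt0 _ _))//.
by rewrite ler_pdivrMr// mul1r ler_nat !ltnS leq_addr.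
Qed.

(** Averaging [Si (y s)] over [s] multiplies the coefficient of [y ^ (2 k + 1)] by the moment of
    that order; [2 / pi] normalises the limit at infinity to 1. *)
Definition profile_coef n : R^nat := fun k =>
  2 / pi * (Si_coef k * ball_moment n k).

Lemma profile_coef_bounded n :
  fact_bounded (profile_coef n) (2 / pi * ball_moment n 0).
Proof.
move=> k; rewrite /profile_coef.
have pi20 : 0 <= 2 / pi :> R by rewrite divr_ge0// pi_ge0.
rewrite normrM (ger0_norm pi20) -[leRHS]mulrA ler_wpM2l// normrM.
rewrite mulrC (ger0_norm (ltW (ball_moment_gt0 n k))).
rewrite ler_pM ?(ltW (ball_moment_gt0 n k)) ?ball_moment_le//.
by have := @Si_coef_bounded R k; rewrite mul1r.
Qed.

(* With [d = n.+1], [profile n (2 * pi * x)] is [1 - m d x]. *)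
Definition profile n : R -> R := odd_sum (profile_coef n).

Lemma profile0E y : profile 0 y = 2 / pi * Si y.
Proof.
have h : series (fun k => profile_coef 0 k * y ^+ k.*2.+1) @ \oo --> 2 / pi * Si y.
  rewrite (_ : series _ = cst (2 / pi) \* series (fun k => Si_coef k * y ^+ k.*2.+1)).
    by apply: cvgM; [exact: cvg_cst|exact: cvg_odd_sum Si_coef_bounded].
  apply/funext => n; rewrite /series/= mulr_sumr; apply: eq_bigr => k _.
  by rewrite /profile_coef ball_moment_interval; ring.
rewrite -(cvg_lim _ h)//; apply/esym/cvg_lim => //.
exact: cvg_odd_sum (profile_coef_bounded 0).
Qed.

Lemma continuous_cosX_sin_Si p y :
  continuous (fun t => cos t ^+ p * sin t ^+ 1 * Si (y * sin t)).
Proof.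
move=> t; apply: cvgM; first exact: continuous_cosX_sinX.
apply: (@continuous_comp _ _ _ (fun t => y * sin t) (@Si R)); last exact: continuous_Si.
by apply: cvgM; [exact: cvg_cst|exact: continuous_sin].
Qed.

Lemma normr_cosX_sin p t : `|cos t ^+ p * sin t ^+ 1| <= 1 :> R.
Proof.
rewrite normrM !normrX expr1 -[leRHS]mulr1 ler_pM ?sin_max ?exprn_ge0//.
by rewrite exprn_ile1// cos_max.
Qed.

(** The series of [Si (y * sin t)] is integrated term by term, each power of the sine giving a
    [trig_moment] that [ball_momentE] identifies. *)
Lemma profileSE p y : profile p.+1 y = 2 / pi * (p.+1%:R *
  \int[mu]_(t in `[0, pi / 2]) (cos t ^+ p * sin t ^+ 1 * Si (y * sin t))).
Proof.
pose s t := series (fun k => Si_coef k * (y * sin t) ^+ k.*2.+1).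
pose u n t := cos t ^+ p * sin t ^+ 1 * s t n.
have cs n : continuous (s ^~ n).
  elim: n => [|n IH] t.
    rewrite (_ : s ^~ 0%N = cst 0); first exact: cvg_cst.
    by apply/funext => x; rewrite /s /series/= big_geq.
  rewrite (_ : s ^~ n.+1 = (s ^~ n) \+ (fun t => Si_coef n * (y * sin t) ^+ n.*2.+1)).
    apply: cvgD; first exact: IH.
    apply: cvgM; first exact: cvg_cst.
    apply: (@continuous_comp _ _ _ (fun t => y * sin t) (fun x => x ^+ n.*2.+1)).
      by apply: cvgM; [exact: cvg_cst|exact: continuous_sin].
    exact: exprn_continuous.
  by apply/funext => x; rewrite /s seriesSr.
have cu n : continuous (u n).
  by move=> t; apply: cvgM; [exact: continuous_cosX_sinX|exact: cs].
have uE n : \int[mu]_(t in `[0, pi / 2]) u n t =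
    series (fun k => Si_coef k * y ^+ k.*2.+1 * trig_moment p k.*2.+2) n.
  elim: n => [|n IH].
    rewrite [RHS]/series/= big_geq// (@eq_Rintegral _ _ _ mu _ (cst 0)).
      by rewrite Rintegral_cst//= mul0r.
    by move=> t _; rewrite /u /s /series/= big_geq// mulr0.
  rewrite seriesSr -IH /trig_moment -RintegralZl//; last exact: integrable_cosX_sinX.
  rewrite -RintegralD//; first last.
  - apply: continuous_integrable => t; apply: cvgM; first exact: cvg_cst.
    exact: continuous_cosX_sinX.
  - exact: continuous_integrable.
  apply: eq_Rintegral => t _; rewrite /u /s seriesSr exprMn [sin t ^+ n.*2.+2]exprS expr1.
  ring.
have cvgu : \int[mu]_(t in `[0, pi / 2]) u n t @[n --> \oo] -->
    \int[mu]_(t in `[0, pi / 2]) (cos t ^+ p * sin t ^+ 1 * Si (y * sin t)).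
  (* The majorant is that of [normr_odd_series] with [C = 1], after bounding [|sin t|] by 1. *)
  apply: (@bounded_convergence _ _ _ (`|y| * expR (y ^+ 2))).
  - exact: cu.
  - exact: continuous_cosX_sin_Si.
  - move=> n t _; rewrite /u normrM -[leRHS]mul1r ler_pM ?normr_cosX_sin//.
    apply: (le_trans (normr_odd_series _ _ Si_coef_bounded)).
    have s1 := sin_max t; rewrite mul1r normrM ler_pM ?mulr_ge0 ?expR_ge0//.
      by rewrite ler_piMr.
    by rewrite ler_expR exprMn ler_piMr ?sqr_ge0.
  - move=> t _; apply: cvgM; first exact: cvg_cst.
    exact: cvg_odd_sum Si_coef_bounded.
set I := Rintegral _ _ _ in cvgu *.
have h : series (fun k => profile_coef p.+1 k * y ^+ k.*2.+1) @ \oo -->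
    2 / pi * (p.+1%:R * I).
  rewrite (_ : series _ = cst (2 / pi) \* (cst p.+1%:R \*
      (fun n => \int[mu]_(t in `[0, pi / 2]) u n t))).
    by apply: cvgM; [exact: cvg_cst|apply: cvgM; [exact: cvg_cst|exact: cvgu]].
  apply/funext => n; rewrite /= uE /series/= !mulr_sumr; apply: eq_bigr => k _.
  by rewrite /profile_coef ball_momentE; ring.
rewrite -(cvg_lim _ h)//; apply/esym/cvg_lim => //.
exact: cvg_odd_sum (profile_coef_bounded p.+1).
Qed.

Lemma profile_ge0 n y : 0 <= y -> 0 <= profile n y.
Proof.
move=> y0; have pi20 : 0 <= 2 / pi :> R by rewrite divr_ge0// pi_ge0.
case: n => [|p]; first by rewrite profile0E mulr_ge0// Si_ge0.
rewrite profileSE; apply: mulr_ge0 => //; apply: mulr_ge0 => //.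
apply: Rintegral_ge0 => t /=; rewrite in_itv/= => tpi; have s0 := sin_ge0_quarter tpi.
apply: mulr_ge0; last by apply: Si_ge0; exact: mulr_ge0.
by apply: mulr_ge0; apply: exprn_ge0 => //; exact: cos_ge0_quarter.
Qed.

Lemma profile_le_Si n y (B : R) : 0 <= y ->
  (forall x, 0 <= x -> Si x <= B) -> profile n y <= 2 / pi * B.
Proof.
move=> y0 SiB; have pi20 : 0 <= 2 / pi :> R by rewrite divr_ge0// pi_ge0.
case: n => [|p]; first by rewrite profile0E ler_wpM2l// SiB.
rewrite profileSE ler_wpM2l//.
(* [B] is rewritten as its own average against the law of mass 1, so that the two integrands can be
   compared. *)
have -> : B = p.+1%:R * (trig_moment p 1 * B) by rewrite mulrA trig_moment_sin_prim mul1r.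
rewrite ler_wpM2l// /trig_moment -RintegralZr//; last exact: integrable_cosX_sinX.
apply: le_Rintegral => //.
- exact: continuous_integrable (@continuous_cosX_sin_Si p y).
- apply: continuous_integrable => t; apply: cvgM; last exact: cvg_cst.
  exact: continuous_cosX_sinX.
- move=> t; rewrite /= in_itv/= => tpi; have s0 := sin_ge0_quarter tpi.
  apply: ler_wpM2l; last by apply: SiB; exact: mulr_ge0.
  by apply: mulr_ge0; apply: exprn_ge0 => //; exact: cos_ge0_quarter.
Qed.

(** For [0 < t < pi / 2] the argument [v n * sin t] tends to [+oo], so [Si] tends to [pi / 2];
    dominated convergence carries this to the average. *)
Lemma cvg_profile n : profile n y @[y --> +oo] --> (1 : R).
Proof.
have pi0 : pi != 0 :> R by rewrite gt_eqF// pi_gt0.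
case: n => [|p].
  rewrite (_ : profile 0 = cst (2 / pi) \* Si); last exact/funext/profile0E.
  rewrite -[X in _ --> X](_ : 2 / pi * (pi / 2) = 1); last by rewrite mulrA divfK// divff.
  by apply: cvgM; [exact: cvg_cst|exact: cvg_Si].
apply: cvgy_ge0_seqP => v v0 vy.
pose I y := \int[mu]_(t in `[0, pi / 2]) (cos t ^+ p * sin t ^+ 1 * Si (y * sin t)).
rewrite (_ : (fun n => _) = cst (2 / pi) \* (cst p.+1%:R \* (I \o v))); last first.
  by apply/funext => n; exact: profileSE.
rewrite -[X in _ --> X](_ : 2 / pi * (p.+1%:R * (trig_moment p 1 * (pi / 2))) = 1); last first.
  by rewrite [X in _ / _ * X]mulrA trig_moment_sin_prim mul1r mulrA divfK// divff.
apply: cvgM; first exact: cvg_cst.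
apply: cvgM; first exact: cvg_cst.
rewrite /trig_moment -RintegralZr//; last exact: integrable_cosX_sinX.
apply: (@bounded_convergence _ _ _ pi).
- by move=> n; exact: continuous_cosX_sin_Si.
- by move=> t; apply: cvgM; [exact: continuous_cosX_sinX|exact: cvg_cst].
- move=> n t tpi; rewrite normrM -[leRHS]mul1r ler_pM ?normr_cosX_sin//.
  have vs0 : 0 <= v n * sin t by rewrite mulr_ge0// sin_ge0_quarter.
  by rewrite ger0_norm ?Si_ge0// Si_le_pi.
- move=> t /andP[t0 tpi]; apply: cvgM; first exact: cvg_cst.
  have s0 : 0 < sin t by rewrite sin_gt0_pihalf// t0.
  have vs : v n * sin t @[n --> \oo] --> +oo.
    apply/cvgryPge => A; near=> n; rewrite -ler_pdivrMr//.
    by near: n; move/cvgryPge : vy; exact.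
  exact: (cvg_comp _ _ vs cvg_Si).
Unshelve. all: by end_near. Qed.

End moments.

(** * Bessel functions of order d / 2 *)

Section bessel.
Context {R : realType}.
Implicit Types (r x y : R) (n k : nat).
Local Notation mu := (@lebesgue_measure R).

Definition m_factor (d : nat) : R :=
  2 `^ (d%:R / 2) * Gamma ((d%:R + 1) / 2) / Num.sqrt pi.

Lemma m_factorE n : m_factor n.+1 = 2 `^ (n.+1%:R / 2) * Gamma_half n / Num.sqrt pi.
Proof. by rewrite /m_factor /Gamma_half natr1. Qed.

Lemma m_factor_gt0 n : 0 < m_factor n.+1.
Proof.
by rewrite m_factorE divr_gt0 ?mulr_gt0 ?powR_gt0 ?Gamma_half_gt0// sqrtr_gt0 pi_gt0.
Qed.

(** With [d = n.+1], [k + d / 2 + 1] is [(2 k + n + 3) / 2]: the Gamma factor of the Bessel series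
    is the one in the denominator of [ball_moment]. The factor [2 k + 1] comes from differentiating
    [profile]. *)
Lemma besselJ_coefE n r k : 0 < r ->
  m_factor n.+1 * r `^ (- (n.+1%:R / 2)) * besselJ_coef (n.+1%:R / 2) r k =
  (2 * k%:R + 1) * profile_coef n k * (r ^+ 2) ^+ k.
Proof.
move=> r0; have r20 : 0 < r / 2 by rewrite divr_gt0.
rewrite m_factorE /besselJ_coef.
have -> : Gamma (k%:R + n.+1%:R / 2 + 1) = Gamma_half (k.*2 + n).+1 :> R.
  rewrite /Gamma_half; congr Gamma.
  have -> : (k.*2 + n).+3%:R = 2 * k%:R + n.+1%:R + 2 :> R.
    by rewrite -natrM -!natrD mul2n addn2 addnS.
  by field.
rewrite powRD; last by rewrite (gt_eqF r20) implybT.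
rewrite -natrM powR_mulrn ?ltW// exprM.
have -> : r `^ (- (n.+1%:R / 2)) = (2 `^ (n.+1%:R / 2) * (r / 2) `^ (n.+1%:R / 2))^-1.
  by rewrite -powRM ?ltW// mulrCA divff// mulr1 powRN.
rewrite /profile_coef /Si_coef /ball_moment.
have a0 : 2 `^ (n.+1%:R / 2) != 0 :> R by rewrite gt_eqF// powR_gt0.
have b0 : (r / 2) `^ (n.+1%:R / 2) != 0 by rewrite gt_eqF// powR_gt0.
have c0 := Gamma_half_neq0 (R := R) (k.*2 + n).+1.
have f0 i : i`!%:R != 0 :> R by rewrite pnatr_eq0 -lt0n fact_gt0.
have e0 : 4 ^+ k != 0 :> R by rewrite expf_neq0.
have s0 := @sqrtpi_neq0 R.
have -> : pi = Num.sqrt pi ^+ 2 :> R by rewrite sqr_sqrtr// pi_ge0.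
rewrite sqrtr_sqr (ger0_norm (sqrtr_ge0 _)).
have -> : ((r / 2) ^+ 2) ^+ k = (r ^+ 2) ^+ k / 4 ^+ k.
  by rewrite -exprVn -exprMn; congr (_ ^+ k); field.
have k0 : 2 * k%:R + 1 != 0 :> R by rewrite gt_eqF// ltr_wpDl// mulr_ge0.
have f1 := f0 k; have f2 := f0 k.*2.+1.
move: a0 b0 c0 e0 s0 k0 f1 f2; rewrite natrM.
move: (2 `^ _) ((r / 2) `^ _) (Gamma_half (k.*2 + n).+1) (4 ^+ k) (Num.sqrt pi) (2 * k%:R + 1).
move: (k`!%:R : R) (k.*2.+1`!%:R : R) ((r ^+ 2) ^+ k) ((-1) ^+ k) (Gamma_half n).
move=> f1 f2 u v w a b c e s h a0 b0 c0 e0 s0 h0 f10 f20.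
by field; rewrite a0 b0 c0 e0 s0 h0 f10 f20.
Qed.

(** Dividing the termwise identity by a nonzero factor shows that the Bessel series converges, so
    the [limn] in [besselJ] is a genuine sum. *)
Lemma m_integrandE n r : 0 < r ->
  @m_integrand R n.+1 r = (m_factor n.+1)^-1 * odd_sum_derive (profile_coef n) r.
Proof.
move=> r0; set c := m_factor n.+1.
have c0 : c != 0 by rewrite gt_eqF// m_factor_gt0.
set p := r `^ (- (n.+1%:R / 2)).
have p0 : p != 0 by rewrite gt_eqF// powR_gt0.
have h : series (besselJ_coef (n.+1%:R / 2) r) @ \oo -->
    (c * p)^-1 * odd_sum_derive (profile_coef n) r.
  rewrite (_ : series _ = cst ((c * p)^-1) \*
      pseries (fun k => (2 * k%:R + 1) * profile_coef n k) (r ^+ 2)).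
    apply: cvgM; first exact: cvg_cst.
    exact: cvg_odd_sum_derive (profile_coef_bounded n).
  apply/funext => N; rewrite /pseries /series/= mulr_sumr; apply: eq_bigr => k _.
  by rewrite -besselJ_coefE// mulKf// mulf_neq0.
rewrite /m_integrand /besselJ (cvg_lim _ h)// -/p.
by rewrite invfM mulrA [p * _]mulrCA divff// mulr1.
Qed.

Lemma is_derive_profile n y :
  is_derive y 1 (profile n) (odd_sum_derive (profile_coef n) y).
Proof. exact: is_derive_odd_sum (profile_coef_bounded n). Qed.

Lemma integral_upto_m_integrand n (a b : R) : 0 <= a -> a <= b ->
  integral_upto (@m_integrand R n.+1) a b =
  (m_factor n.+1)^-1 * (profile n b - profile n a).
Proof.
move=> a0 ab; pose g : R -> R := odd_sum_derive (profile_coef n).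
have cg : continuous g := continuous_odd_sum_derive (profile_coef_bounded n).
have ig := @continuous_integrable R g a b cg.
have -> : profile n b - profile n a = \int[mu]_(r in `[a, b]) g r.
  apply/esym/Rintegral_is_derive => //.
  - exact: is_derive_continuous (is_derive_profile n).
  - by move=> x _; exact: is_derive_profile.
rewrite -RintegralZl// /integral_upto.
have cg' : continuous (fun r => (m_factor n.+1)^-1 * g r).
  by move=> r; apply: cvgM; [exact: cvg_cst|exact: cg].
have ig' : mu.-integrable `]a, b] (EFin \o (fun r => (m_factor n.+1)^-1 * g r)).
  apply: integrableS (@continuous_integrable R _ a b cg') => //.
  exact: subset_itv_oc_cc.
(* [m_integrandE] holds for [r > 0] and [a] may be 0, hence the passage to []a, b]]. *)
have e r : r \in (`]a, b] : set R)%classic ->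
    (m_factor n.+1)^-1 * g r = @m_integrand R n.+1 r.
  rewrite inE/= in_itv/= => /andP[ar _].
  by rewrite m_integrandE// (le_lt_trans a0).
rewrite -[RHS]Rintegral_itv_obnd_cbnd// -[LHS]Rintegral_itv_obnd_cbnd; last first.
  by apply: eq_integrable ig' => // r rI /=; congr EFin; exact: e.
by apply: eq_Rintegral => r rI; rewrite e.
Qed.

Lemma cvg_integral_upto_m_integrand n (a : R) : 0 <= a ->
  integral_upto (@m_integrand R n.+1) a b @[b --> +oo] -->
  (m_factor n.+1)^-1 * (1 - profile n a).
Proof.
move=> a0.
have h : (m_factor n.+1)^-1 * (profile n b - profile n a) @[b --> +oo] -->
    (m_factor n.+1)^-1 * (1 - profile n a).
  apply: cvgM; first exact: cvg_cst.
  by apply: cvgB; [exact: cvg_profile|exact: cvg_cst].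
apply: cvg_trans h; apply: near_eq_cvg; near=> b.
by rewrite integral_upto_m_integrand//; near: b; exact: nbhs_pinfty_ge.
Unshelve. all: by end_near. Qed.

Lemma m_profile n x : 0 <= x -> m n.+1 x = 1 - profile n (2 * pi * x).
Proof.
move=> x0; have a0 : 0 <= 2 * pi * x by rewrite !mulr_ge0// pi_ge0.
rewrite /m -/(m_factor n.+1) /improper_integral.
rewrite (cvg_lim _ (cvg_integral_upto_m_integrand a0))// mulVKf//.
by rewrite gt_eqF// m_factor_gt0.
Qed.

End bessel.

Theorem theorem1 (R : realType) (d : nat) (d_ge1 : (1 <= d)%N) :
  [/\ forall x : R, 0 <= x -> improper_cvg (@m_integrand R d) (2 * pi * x),
      forall (t : R) (xi : 'rV[R]_d), 0 < t ->
        1 - 2 / pi * (\int[lebesgue_measure]_(s in `[0, pi]) (sin s / s))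
          <= m d (t * euclidean_norm xi) <= 1,
      is_max [set y : R | exists (t : R) (xi : 'rV[R]_d),
                0 < t /\ y = `| m d (t * euclidean_norm xi) |] (m d 0)
    & m d (0 : R) = 1].
Proof.
case: d d_ge1 => // n _.
have arg0 (x : R) : 0 <= x -> 0 <= 2 * pi * x by move=> x0; rewrite !mulr_ge0// pi_ge0.
have norm0 (t : R) (xi : 'rV[R]_n.+1) : 0 < t -> 0 <= t * euclidean_norm xi.
  by move=> t0; rewrite mulr_ge0 ?sqrtr_ge0// ltW.
have m0 : m n.+1 (0 : R) = 1.
  by rewrite m_profile// mulr0 /profile /odd_sum mul0r subr0.
have pi0 := pi_gt0 R.
split => //.
- move=> x /arg0 a0; apply/cvg_ex; eexists.
  exact: cvg_integral_upto_m_integrand.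
- move=> t xi /(norm0 t xi) y0; rewrite m_profile// Rintegral_sin_div.
  rewrite lerD2l lerN2 profile_le_Si ?arg0//=; last exact: Si_le_Si_pi.
  by rewrite lerBlDr lerDl profile_ge0// arg0.
- rewrite m0; split.
    (* The value at 0 is reached with [xi = 0], for any positive [t]. *)
    exists 1, 0; split => //.
    rewrite /euclidean_norm big1 ?sqrtr0 ?mulr0 ?m0 ?normr1// => i _.
    by rewrite mxE expr0n.
  move=> _ [t [xi [/(norm0 t xi) y0 ->]]]; rewrite m_profile//.
  (* [0 <= profile <= 2 / pi * pi = 2] places [1 - profile] between -1 and 1. *)
  have := @profile_ge0 R n _ (arg0 _ y0).
  have := @profile_le_Si R n _ _ (arg0 _ y0) (@Si_le_pi R).
  rewrite divfK ?gt_eqF// ler_norml; lra.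
Qed.
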